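(* Let $p\in[2,\infty)$ and let $(Y,\mathcal{M},\mu)$ be a measure space with $\mu(Y)<\infty$. Let $(e_n)_{n\in\mathbb{N}^\star}$ be an orthonormal basis of $L^2(Y,\mathcal{M},\mu)$, let $(g_n)_{n\in\mathbb{N}^\star}$ be a sequence of independent $\mathcal{N}_{\mathbb{C}}(0,1)$ Gaussian random variables on a probability space $(\Omega,\mathcal{A},P)$, let $c=(c_n)_{n\in\mathbb{N}^\star}\in l^2(\mathbb{N}^\star)$, and consider the random series $$F_c(\omega)=\sum_{n\in\mathbb{N}^\star} g_n(\omega)\,c_n\,e_n .$$ If $$\sum_{n\in\mathbb{N}^\star}|c_n|^p\,\|e_n\|_{L^p(Y,\mathcal{M},\mu)}^p=\infty,$$ then $\|F_c(\omega)\|_{L^p(Y,\mathcal{M},\mu)}=\infty$ almost surely.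
   Context: $\mathbb{N}^\star=\{1,2,3,\dots\}$. $L^p$ and $l^2(\mathbb{N}^\star)$ are spaces of complex-valued functions and sequences. An $\mathcal{N}_{\mathbb{C}}(0,\sigma^2)$ Gaussian random variable ($\sigma>0$) is a complex-valued random variable with density $\frac{1}{2\pi\sigma^2}e^{-|z|^2/(2\sigma^2)}$ on $\mathbb{C}$; equivalently $X=X_1+iX_2$ with $X_1,X_2$ independent real centered Gaussians of variance $\sigma^2$, so $\mathbb{E}|X|^2=2\sigma^2$. The series $F_c$ is defined as the limit in $L^2(\Omega\times Y)$ (with respect to $P\otimes\mu$) of its partial sums; for $P$-almost every $\omega$, $F_c(\omega)\in L^2(Y,\mathcal{M},\mu)$ and its coordinates in the basis $(e_n)$ are $g_n(\omega)c_n$. For $f\in L^2(Y,\mathcal{M},\mu)$, $\|f\|_{L^p(Y,\mathcal{M},\mu)}=\left(\int_Y|f|^p\,d\mu\right)^{1/p}\in[0,\infty]$, with value $\infty$ if $f\notin L^p$. Convention: $0\cdot\infty=0$. *)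

(* Defs.v *)
From HB Require Import structures.
From mathcomp Require Import all_boot all_order all_algebra finmap.
From mathcomp Require Import all_classical all_reals all_analysis.
From mathcomp Require Import complex.
Import Order.TTheory GRing.Theory Num.Theory.
Import numFieldNormedType.Exports.
Import ComplexField.Normc.

Set Implicit Arguments.
Unset Strict Implicit.
Unset Printing Implicit Defensive.

Local Open Scope classical_set_scope.
Local Open Scope ring_scope.
Local Open Scope complex_scope.

(* Sequences indexed by {1, 2, ...} are represented by functions on nat: the
   value at n : nat is the (n + 1)-st term.

   Elements of L^p are represented by functions, not by classes modulo
   almost-everywhere equality. *)

(* R[i] carries the Borel sigma-algebra of the plane, transported along the
   bijection (x, y) |-> x +i* y. *)
Section complex_measurable.
Context {R : realType}.

Definition complex_of_pair (xy : measurableTypeR R * measurableTypeR R) :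
  R[i] := (xy.1 : R) +i* (xy.2 : R).

Definition complex_measurable : set (set R[i]) :=
  [set A | measurable (complex_of_pair @^-1` A)].

Let complex_measurable0 : complex_measurable set0.
Proof. by rewrite /complex_measurable /= preimage_set0; exact: measurable0. Qed.

Let complex_measurableC A :
  complex_measurable A -> complex_measurable (~` A).
Proof. by rewrite /complex_measurable /= preimage_setC; exact: measurableC. Qed.

Let complex_measurable_bigcup (F : (set R[i])^nat) :
  (forall i, complex_measurable (F i)) -> complex_measurable (\bigcup_i F i).
Proof.
rewrite /complex_measurable /= preimage_bigcup => mF.
exact: bigcupT_measurable.
Qed.

HB.instance Definition _ := isPointed.Build R[i] 0.
HB.instance Definition _ := isMeasurable.Build default_measure_display R[i]
  complex_measurable0 complex_measurableC complex_measurable_bigcup.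

Lemma measurable_complex_of_pair :
  measurable_fun [set: measurableTypeR R * measurableTypeR R] complex_of_pair.
Proof. by move=> _ A mA; rewrite setTI. Qed.

HB.instance Definition _ := isMeasurableFun.Build _ _ _ _
  complex_of_pair measurable_complex_of_pair.

End complex_measurable.

Section complex_lebesgue.
Context {R : realType}.

Let lebesgue2 : {measure set (measurableTypeR R * measurableTypeR R) -> \bar R} :=
  (@lebesgue_measure R \x @lebesgue_measure R)%E.

Definition complex_lebesgue : set R[i] -> \bar R :=
  pushforward lebesgue2 complex_of_pair.

Let complex_lebesgue0 : complex_lebesgue set0 = 0%E.
Proof. by rewrite /complex_lebesgue /pushforward preimage_set0 measure0. Qed.

Let complex_lebesgue_ge0 A : (0 <= complex_lebesgue A)%E.
Proof. exact: measure_ge0. Qed.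

Let complex_lebesgue_sigma_additive : semi_sigma_additive complex_lebesgue.
Proof.
move=> F mF tF mUF; rewrite /complex_lebesgue /pushforward preimage_bigcup.
apply: measure_semi_sigma_additive.
- by move=> n; exact: mF.
- apply/trivIsetP => /= i j _ _ ij; rewrite -preimage_setI.
  by move/trivIsetP : tF => /(_ _ _ _ _ ij) ->//; rewrite preimage_set0.
- by rewrite -preimage_bigcup; exact: mUF.
Qed.

HB.instance Definition _ := isMeasure.Build _ _ _ complex_lebesgue
  complex_lebesgue0 complex_lebesgue_ge0 complex_lebesgue_sigma_additive.

End complex_lebesgue.

Section complex_Lp.
Context d (T : measurableType d) (R : realType).
Variable mu : {measure set T -> \bar R}.
Implicit Types f h : T -> R[i].

(* normc is the modulus as an element of R; `|z| would live in R[i]. *)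
Definition cLnorm (p : R) f : \bar R := Lnorm mu p%:E (fun x => (normc (f x))%:E).

Definition in_L2 f : Prop := measurable_fun [set: T] f /\ (cLnorm 2 f < +oo)%E.

Definition cintegral f : R[i] :=
  (\int[mu]_x complex.Re (f x)) +i* (\int[mu]_x complex.Im (f x)).

Definition cdot f h : R[i] := cintegral (fun x => f x * (h x)^*).

Record orthonormal_basis (e : nat -> T -> R[i]) : Prop := OrthonormalBasis {
  orthonormal_basis_L2 : forall n, in_L2 (e n) ;
  orthonormal_basis_dot : forall m n, cdot (e m) (e n) = (m == n)%:R ;
  orthonormal_basis_dense : forall f, in_L2 f -> forall eps : R, 0 < eps ->
    exists (N : nat) (a : nat -> R[i]),
      (cLnorm 2 (fun x => f x - \sum_(n < N) a n * e n x)%R < eps%:E)%E }.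

End complex_Lp.

Section complex_random_variables.
Context d (Omega : measurableType d) (R : realType).
Variable P : probability Omega R.

(* Beware of the normalization: sigma ^+ 2 is the variance of each of the real
   and imaginary parts. *)
Definition complex_gaussian_pdf (sigma : R) (z : R[i]) : R :=
  (2 * pi * sigma ^+ 2)^-1 * expR (- (normc z ^+ 2 / (2 * sigma ^+ 2))).

Definition complex_gaussian (sigma : R) (X : {RV P >-> R[i]}) : Prop :=
  forall A : set R[i], measurable A ->
    distribution P X A =
    (\int[@complex_lebesgue R]_(z in A) (complex_gaussian_pdf sigma z)%:E)%E.

Definition mutually_independent (X : nat -> {RV P >-> R[i]}) : Prop :=
  forall (J : {fset nat}) (B : nat -> set R[i]), (forall n, measurable (B n)) ->
    P (\bigcap_(n in [set` J]) (X n @^-1` B n)) =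
    (\prod_(n <- J) P (X n @^-1` B n))%E.

End complex_random_variables.

Definition in_l2 (R : realType) (c : nat -> R[i]) : Prop :=
  (\sum_(0 <= n <oo) (normc (c n) ^+ 2)%:E < +oo)%E.

(* F, viewed as a function on Omega * Y, represents the L^2(P \x mu)-limit of
   the partial sums; it is determined up to a (P \x mu)-null set. *)
Definition is_gaussian_series d1 d2 (Omega : measurableType d1)
    (Y : measurableType d2) (R : realType) (P : probability Omega R)
    (mu : {finite_measure set Y -> \bar R}) (g : nat -> {RV P >-> R[i]})
    (c : nat -> R[i]) (e : nat -> Y -> R[i]) (F : Omega * Y -> R[i]) : Prop :=
  in_L2 (P \x mu)%E F /\
  cLnorm (P \x mu)%E 2
    (fun wy => F wy - \sum_(n < N) g n wy.1 * c n * e n wy.2)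
    @[N --> \oo] --> 0%E.

(* Main.v *)
Require Import Defs.
From HB Require Import structures.
From mathcomp Require Import all_boot all_order all_algebra finmap.
From mathcomp Require Import all_classical all_reals all_analysis.
From mathcomp Require Import measurable_realfun ring lra.
From mathcomp Require Import complex.
Import Order.TTheory GRing.Theory Num.Theory.
Import numFieldNormedType.Exports.
Import ComplexField.Normc.
Import HBNNSimple.

Set Implicit Arguments.
Unset Strict Implicit.
Unset Printing Implicit Defensive.

Local Open Scope classical_set_scope.
Local Open Scope ring_scope.
Local Open Scope complex_scope.

(** The theorem is a consequence of the anti-concentration of Gaussian sums.

Put [a_n = c_n e_n(y)] and [s_K(y) = \sum_(n < K) |a_n|^2].  For almost every
[y], the random variable [F(., y)] is a limit of the Gaussian sums
[S_N = \sum_(n < N) g_n a_n], and so it rarely falls in a disc whose radius is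
small with respect to [sqrt (s_K(y))] ([ae_series_small_ball]): the probability
of the disc of radius [t sqrt (s_K(y))] is at most [4 exp(1/2) t^2].

Suppose now that [int_Y |F(w, .)|^p <= M] on an event [A] of probability
[delta > 0].  Choose [t], depending only on [delta], such that the disc above
has probability at most [delta / 2]; then [|F(., y)| >= t sqrt (s_K(y))] on at
least half of [A], and
[[ int_A |F(., y)|^p dP >= (delta / 2) t^p s_K(y)^(p/2)
                        >= (delta / 2) t^p \sum_(n < K) |c_n e_n(y)|^p, ]]
where the last step uses [p >= 2] ([moment_lower_bound]).  Integrating in [y]
and exchanging the integrals bounds [\sum_(n < K) |c_n|^p ||e_n||_p^p] by a
constant times [M], uniformly in [K] ([sum_moments_bound]).  If the full sum
diverges, every such event [A] is therefore null, and the event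
[||F(w, .)||_p < oo] is a countable union of such events.

The small ball estimate comes from the heat kernel
[heat v z = exp(- |z|^2 / (2 v))].  Averaging it against one Gaussian reproduces
it, [E (heat v (z + a g)) = v / (v + |a|^2) * heat (v + |a|^2) z], so that
independence and an induction on [N] give
[E (heat v S_N) = v / (v + \sum_(n < N) |a_n|^2)], and Markov's inequality for
[heat (r^2)] concludes ([gaussian_sum_small_ball]).  The bound passes to
[F(., y)] because [S_N] is, for almost every [y] and for infinitely many [N],
arbitrarily close to [F(., y)] in mean square ([limit_small_ball],
[ae_frequently_small]). *)

(** * Complex-valued measurable functions *)

Section complex_borel.
Context {R : realType} d {T : measurableType d}.
Implicit Types f h : T -> R[i].

Lemma measurable_Re : measurable_fun [set: R[i]] (@complex.Re R).
Proof.
move=> _ B mB; rewrite setTI /measurable/= /complex_measurable/=.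
have := @measurable_fst _ _ (measurableTypeR R) (measurableTypeR R)
  measurableT _ mB.
by rewrite setTI.
Qed.

Lemma measurable_Im : measurable_fun [set: R[i]] (@complex.Im R).
Proof.
move=> _ B mB; rewrite setTI /measurable/= /complex_measurable/=.
have := @measurable_snd _ _ (measurableTypeR R) (measurableTypeR R)
  measurableT _ mB.
by rewrite setTI.
Qed.

Lemma measurable_complexP f :
  measurable_fun setT f <->
  measurable_fun setT (fun x => complex.Re (f x)) /\
  measurable_fun setT (fun x => complex.Im (f x)).
Proof.
split=> [mf|[mRe mIm]].
  split; apply: measurableT_comp mf.
    exact: measurable_Re.
  exact: measurable_Im.
have -> : f = complex_of_pair \o
    (fun x => (complex.Re (f x) : measurableTypeR R,
               complex.Im (f x) : measurableTypeR R)).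
  by apply/funext => x /=; rewrite /complex_of_pair/=; case: (f x).
apply: measurableT_comp; first exact: measurable_complex_of_pair.
exact: measurable_fun_pair.
Qed.

Lemma measurable_complexD f h :
  measurable_fun setT f -> measurable_fun setT h ->
  measurable_fun setT (fun x => f x + h x).
Proof.
move=> /measurable_complexP[fr fi] /measurable_complexP[hr hi].
apply/measurable_complexP; split.
- rewrite (_ : (fun x => _) = (fun x => complex.Re (f x) + complex.Re (h x))).
    exact: measurable_funD.
  by apply/funext => x; case: (f x) (h x) => [a b] [a' b'].
- rewrite (_ : (fun x => _) = (fun x => complex.Im (f x) + complex.Im (h x))).
    exact: measurable_funD.
  by apply/funext => x; case: (f x) (h x) => [a b] [a' b'].
Qed.

Lemma measurable_complexN f :
  measurable_fun setT f -> measurable_fun setT (fun x => - f x).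
Proof.
move=> /measurable_complexP[fr fi].
apply/measurable_complexP; split.
- rewrite (_ : (fun x => _) = (fun x => - complex.Re (f x))).
    exact: measurableT_comp.
  by apply/funext => x; case: (f x).
- rewrite (_ : (fun x => _) = (fun x => - complex.Im (f x))).
    exact: measurableT_comp.
  by apply/funext => x; case: (f x).
Qed.

Lemma measurable_complexM f h :
  measurable_fun setT f -> measurable_fun setT h ->
  measurable_fun setT (fun x => f x * h x).
Proof.
move=> /measurable_complexP[fr fi] /measurable_complexP[hr hi].
apply/measurable_complexP; split.
- rewrite (_ : (fun x => _) = (fun x => complex.Re (f x) * complex.Re (h x)
      - complex.Im (f x) * complex.Im (h x))).
    by apply: measurable_funB; exact: measurable_funM.
  by apply/funext => x; case: (f x) (h x) => [a b] [a' b'].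
- rewrite (_ : (fun x => _) = (fun x => complex.Re (f x) * complex.Im (h x)
      + complex.Im (f x) * complex.Re (h x))).
    by apply: measurable_funD; exact: measurable_funM.
  by apply/funext => x; case: (f x) (h x) => [a b] [a' b'].
Qed.

Lemma measurable_complex_sum (f : nat -> T -> R[i]) N :
  (forall n, measurable_fun setT (f n)) ->
  measurable_fun setT (fun x => \sum_(n < N) f n x).
Proof.
move=> mf; elim: N => [|N IH].
  by under eq_fun do rewrite big_ord0; exact: measurable_cst.
by under eq_fun do rewrite big_ord_recr/=; exact: measurable_complexD.
Qed.

Lemma normc_sqr (z : R[i]) :
  normc z ^+ 2 = complex.Re z ^+ 2 + complex.Im z ^+ 2.
Proof. by case: z => a b /=; rewrite sqr_sqrtr// addr_ge0// sqr_ge0. Qed.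

Lemma normc_ge0 (z : R[i]) : 0 <= normc z.
Proof. by case: z => a b; exact: sqrtr_ge0. Qed.

Lemma measurable_normc f :
  measurable_fun setT f -> measurable_fun setT (fun x => normc (f x)).
Proof.
move=> /measurable_complexP[fr fi].
rewrite (_ : (fun x => _) = (fun x =>
  (complex.Re (f x) ^+ 2 + complex.Im (f x) ^+ 2) `^ 2^-1)).
  apply: (measurableT_comp (measurable_powR _)).
  by apply: measurable_funD; exact: measurable_funX.
apply/funext => x; rewrite -normc_sqr powR12_sqrt ?sqr_ge0// sqrtr_sqr.
by rewrite ger0_norm// normc_ge0.
Qed.

Lemma measurable_le_normc f r :
  measurable_fun setT f -> measurable [set x | normc (f x) <= r].
Proof.
move=> /measurable_normc /(_ measurableT `]-oo, r]%classic (measurable_itv _)).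
by rewrite setTI; congr (measurable _).
Qed.

End complex_borel.

(** * Integration against a measure with a density *)

Section density.
Local Open Scope ereal_scope.
Context d (T : measurableType d) (R : realType).
Variables (mu nu : {measure set T -> \bar R}) (rho : T -> R).
Hypothesis mrho : measurable_fun setT rho.
Hypothesis rho0 : forall x, (0 <= rho x)%R.
Hypothesis nuE : forall A, measurable A -> nu A = \int[mu]_(x in A) (rho x)%:E.

Lemma ge0_integral_density (f : T -> \bar R) :
  measurable_fun setT f -> (forall x, 0 <= f x) ->
  \int[nu]_x f x = \int[mu]_x (f x * (rho x)%:E).
Proof.
move=> mf f0; pose f_ := nnsfun_approx measurableT mf.
have f_f x : EFin \o f_ ^~ x @ \oo --> f x.
  by apply: cvg_nnsfun_approx => // y _; exact: f0.
transitivity (limn (fun n => \int[nu]_x (f_ n x)%:E)).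
  rewrite -monotone_convergence//.
  - by apply: eq_integral => y _; apply/esym/cvg_lim => //; exact: f_f.
  - by move=> n; exact/measurable_EFinP/measurable_funP.
  - by move=> n y _; rewrite lee_fin.
  - by move=> y _ m n mn; rewrite lee_fin; exact/lefP/nd_nnsfun_approx.
rewrite [X in limn X](_ : _ =
    (fun n => \int[mu]_x ((f_ n x)%:E * (rho x)%:E))).
  rewrite -monotone_convergence//; last 3 first.
  - move=> n; apply: emeasurable_funM; last exact/measurable_EFinP.
    exact/measurable_EFinP/measurable_funP.
  - by move=> n x _; rewrite -EFinM lee_fin mulr_ge0.
  - move=> x _ m n mn; rewrite -!EFinM lee_fin ler_wpM2r//.
    exact/lefP/nd_nnsfun_approx.
  apply: eq_integral => x _; apply/cvg_lim => //.
  by apply: cvgeZr => //; exact: f_f.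
apply/funext => n.
have mk k : measurable (f_ n @^-1` [set k]) by exact: measurable_funPTI.
under eq_integral do rewrite fimfunE -fsumEFin//.
rewrite ge0_integral_fsum//; last 2 first.
- by move=> k; exact/measurable_EFinP/measurable_funM.
- by move=> k x _; rewrite nnfun_muleindic_ge0.
have kge0 k x : 0 <= (k * \1_(f_ n @^-1` [set k]) x)%:E.
  by rewrite EFinM nnfun_muleindic_ge0.
transitivity (\int[mu]_x
    \sum_(k \in range (f_ n)) (k * \1_(f_ n @^-1` [set k]) x)%:E * (rho x)%:E);
  last first.
  by apply: eq_integral => x _; rewrite -ge0_mule_fsuml// fsumEFin// -fimfunE.
rewrite ge0_integral_fsum//; last 2 first.
- move=> k; apply: emeasurable_funM; last exact/measurable_EFinP.
  exact/measurable_EFinP/measurable_funM.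
- by move=> k x _; rewrite mule_ge0 // lee_fin.
apply: eq_fsbigr => k _.
rewrite integralZl_indic_nnsfun// integral_indic// setIT nuE//.
have [k0|k0] := ltP k 0%R.
  rewrite preimage_nnfun0// integral_set0 mule0 integral0_eq// => x _.
  by rewrite indic0 mulr0 mul0e.
under [RHS]eq_integral => x _ do rewrite EFinM -muleA muleC.
rewrite integral_mkcond -ge0_integralZl//; last 2 first.
- apply/(measurable_restrictT _ _).1 => //.
  exact/measurable_funTS/measurable_EFinP.
- by move=> x _; rewrite erestrict_ge0// => y _; rewrite lee_fin.
apply: eq_integral => x _; rewrite patchE/= muleC; congr (_ * _).
by rewrite indicE; case: ifPn => xk; rewrite ?mul1e ?mul0e.
Qed.

End density.

(** * The heat kernel and one Gaussian variable *)

Section heat.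
Context {R : realType}.
Implicit Types (v : R) (z a : R[i]).

Definition heat v z : R := expR (- (normc z ^+ 2 / (2 * v))).

Lemma heat_ge0 v z : 0 <= heat v z. Proof. exact: expR_ge0. Qed.

Lemma measurable_heat v d (T : measurableType d) (f : T -> R[i]) :
  measurable_fun setT f -> measurable_fun setT (fun x => heat v (f x)).
Proof.
move=> mf; apply: (measurableT_comp (@measurable_expR R)).
apply: (measurableT_comp (@oppr_measurable R setT)).
apply: measurable_funM => //; apply: measurable_funX.
exact: measurable_normc.
Qed.

(** Completing the square in [w = x + i y]:
[[ |z + a w|^2 / v + |w|^2
     = |w - m|^2 / s^2 + |z|^2 / (v + |a|^2) ]]
with [m = - conj(a) z / (v + |a|^2)] and [s^2 = v / (v + |a|^2)].  The right-hand side splits into the real and the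
imaginary part of [w], so that the integral over [w] is a product of two
integrals of normal densities, for every complex [a]. *)
Lemma heat_gaussian_pdf v z a (s := Num.sqrt (v / (v + normc a ^+ 2))) :
  0 < v ->
  exists m1 m2, forall x y,
  heat v (z + a * (x +i* y)) * complex_gaussian_pdf 1 (x +i* y) =
  v / (v + normc a ^+ 2) * heat (v + normc a ^+ 2) z *
    (normal_pdf m1 s x * normal_pdf m2 s y).
Proof.
case: z a @s => z1 z2 [a1 a2] s v0.
set A := normc (a1 +i* a2) ^+ 2.
have AE : A = a1 ^+ 2 + a2 ^+ 2 by rewrite /A normc_sqr.
have A0 : 0 <= A by rewrite AE addr_ge0 ?sqr_ge0.
have vA : 0 < v + A by rewrite ltr_wpDr.
have s2 : s ^+ 2 = v / (v + A) by rewrite sqr_sqrtr// ltW// divr_gt0.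
have s0 : s != 0 by rewrite -sqrf_eq0 s2 gt_eqF// divr_gt0.
exists (- (a1 * z1 + a2 * z2) / (v + A)), (- (a1 * z2 - a2 * z1) / (v + A)).
move=> x y.
rewrite !normal_pdfE// /normal_pdf /normal_fun /complex_gaussian_pdf /heat.
rewrite (mulrACA (normal_peak s)) -expRD.
have -> : normal_peak s * normal_peak s = (v / (v + A) * pi *+ 2)^-1.
  rewrite -expr2 /normal_peak exprVn sqr_sqrtr ?s2//.
  by rewrite mulrn_wge0// mulr_ge0 ?pi_ge0// ltW// divr_gt0.
rewrite mulrCA -expRD s2 expr1n.
rewrite [RHS]mulrACA -expRD.
have -> : v / (v + A) * (v / (v + A) * pi *+ 2)^-1 = (2 * pi * 1)^-1.
  by have := pi_gt0 R; move: (pi : R) => q q0; field; rewrite !gt_eqF.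
congr (_ * expR _).
rewrite !normc_sqr/= AE; rewrite AE in vA; field.
by rewrite !gt_eqF.
Qed.

End heat.

Section gaussian_step.
Context {R : realType} d (Omega : measurableType d) (P : probability Omega R).

Lemma integral_gaussian_heat (X : {RV P >-> R[i]}) v z a :
  complex_gaussian 1 X -> 0 < v ->
  (\int[distribution P X]_w (heat v (z + a * w))%:E =
   (v / (v + normc a ^+ 2) * heat (v + normc a ^+ 2) z)%:E)%E.
Proof.
move=> hX v0.
have mpdf : measurable_fun setT (@complex_gaussian_pdf R 1).
  apply: measurable_funM => //.
  rewrite (_ : (fun _ => _) = heat 1).
    exact: measurable_heat.
  by apply/funext => w; rewrite /heat expr1n.
have pdf0 w : 0 <= complex_gaussian_pdf 1 w :> R.
  by rewrite mulr_ge0 ?expR_ge0// invr_ge0 !mulr_ge0 ?pi_ge0 ?sqr_ge0.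
have mh : measurable_fun setT (fun w => heat v (z + a * w)).
  apply: measurable_heat; apply: measurable_complexD => //.
  exact: measurable_complexM.
rewrite (ge0_integral_density mpdf pdf0 hX); last 2 first.
- exact/measurable_EFinP.
- by move=> w; rewrite lee_fin heat_ge0.
have mhp : measurable_fun setT
    (fun w => (heat v (z + a * w) * complex_gaussian_pdf 1 w)%:E).
  by apply/measurable_EFinP; exact: measurable_funM.
rewrite (eq_measure_integral (pushforward
  (lebesgue_measure \x lebesgue_measure)%E (@complex_of_pair R)))//.
rewrite ge0_integral_pushforward//; last first.
  by move=> w _; rewrite -EFinM lee_fin mulr_ge0// heat_ge0.
rewrite preimage_setT.
have [m1 [m2 E]] := heat_gaussian_pdf z a v0.
set s := Num.sqrt _ in E.
set k := _ / _ * heat _ z.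
have k0 : 0 <= k.
  by rewrite mulr_ge0 ?heat_ge0// divr_ge0 ?ltW// ltr_wpDr ?sqr_ge0.
rewrite fubini_tonelli1; last 2 first.
- exact: (measurableT_comp mhp (@measurable_complex_of_pair R)).
- by move=> w; rewrite /= -EFinM lee_fin mulr_ge0// heat_ge0.
rewrite /fubini_F.
under eq_integral => x _.
  under eq_integral => y _.
    rewrite /= -EFinM [X in X%:E](E x y) mulrA EFinM; over.
  rewrite ge0_integralZl//; last 3 first.
  - by apply/measurable_EFinP; exact: measurable_normal_pdf.
  - by move=> y _; rewrite lee_fin normal_pdf_ge0.
  - by rewrite lee_fin mulr_ge0// normal_pdf_ge0.
  rewrite integral_normal_pdf mule1 EFinM.
  over.
rewrite ge0_integralZl//; last 2 first.
- by apply/measurable_EFinP; exact: measurable_normal_pdf.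
- by move=> y _; rewrite lee_fin normal_pdf_ge0.
by rewrite integral_normal_pdf mule1.
Qed.

End gaussian_step.

(** * Independence of the partial sums *)

Section joint_law.
Local Open Scope ereal_scope.
Context d d1 d2 (Omega : measurableType d) (T1 : measurableType d1)
  (T2 : measurableType d2) (R : realType) (P : probability Omega R).
Variables (S : {mfun Omega >-> T1}) (X : {mfun Omega >-> T2}).

(** The event [E] is carried along because the induction on the number of terms
of a sum needs the independence of the pair [(S, X)] from the later variables.
The case [E = setT] says that the joint law of [S] and [X] is the product of
their laws. *)
Lemma joint_law_indep (E : set Omega) : measurable E ->
  (forall C D, measurable C -> measurable D ->
    P (S @^-1` C `&` X @^-1` D `&` E) =
      P E * (P (S @^-1` C) * P (X @^-1` D))) ->
  forall U : set (T1 * T2), measurable U ->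
  P ([set w | U (S w, X w)] `&` E) =
    P E * (distribution P S \x distribution P X) U.
Proof.
move=> mE indep U mU.
have PE0 : (0 <= fine (P E))%R by exact/fine_ge0/measure_ge0.
pose k := NngNum PE0.
have kE : k%:num%:E = P E by rewrite /= fineK// fin_num_measure.
have mSX : measurable_fun setT (fun w => (S w, X w)).
  exact: measurable_fun_pair.
(* Both sides are finite measures in [U] that agree on rectangles; the factor
   [P E] is put into the first marginal to get a product measure. *)
transitivity ((mscale k (distribution P S) \x distribution P X) U).
  apply/esym.
  apply: (@product_measure_unique _ _ _ _ _
    (mscale k (distribution P S)) (distribution P X)
    (measure_function_pushforward__canonical__measure_function_Measure
       (mrestr P mE) mSX) _ U mU).
  move=> C D mC mD.
  rewrite -[RHS]/(k%:num%:E * P (S @^-1` C) * P (X @^-1` D)).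
  by rewrite kE -muleA -indep.
rewrite /product_measure1 ge0_integral_mscale// ?kE//.
exact: measurable_fun_xsection.
Qed.

End joint_law.

Section gaussian_sum.
Context {R : realType} d (Omega : measurableType d) (P : probability Omega R).
Variable g : nat -> {RV P >-> R[i]}.

Definition gaussian_sum (a : nat -> R[i]) N w : R[i] :=
  \sum_(n < N) g n w * a n.

Lemma gaussian_sumS a N w :
  gaussian_sum a N.+1 w = gaussian_sum a N w + g N w * a N.
Proof. by rewrite /gaussian_sum big_ord_recr. Qed.

Lemma measurable_gaussian_sum a N : measurable_fun setT (gaussian_sum a N).
Proof.
apply: (measurable_complex_sum (f := fun n w => g n w * a n)) => n.
exact: measurable_complexM.
Qed.

HB.instance Definition _ a N := isMeasurableFun.Build _ _ _ _
  (gaussian_sum a N) (measurable_gaussian_sum a N).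

Hypothesis hindep : mutually_independent g.

Let cylinder (J : {fset nat}) (B : nat -> set R[i]) :=
  \bigcap_(n in [set` J]) (g n @^-1` B n).

Let measurable_cylinder J B :
  (forall n, measurable (B n)) -> measurable (cylinder J B).
Proof.
move=> mB; apply: fin_bigcap_measurable => [|n _]; first exact: finite_fset.
exact: measurable_funPTI.
Qed.

Let cylinder0 B : cylinder fset0 B = setT.
Proof. by rewrite /cylinder set_fset0 bigcap_set0. Qed.

(** A condition on one more variable turns a cylinder into a cylinder. *)
Lemma indep_cylinder N (D : set R[i]) (J : {fset nat}) (B : nat -> set R[i]) :
  measurable D -> (forall n, measurable (B n)) -> N \notin J ->
  exists B', [/\ forall n, measurable (B' n),
    cylinder (N |` J)%fset B' = g N @^-1` D `&` cylinder J B &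
    P (cylinder (N |` J)%fset B') = (P (g N @^-1` D) * P (cylinder J B))%E].
Proof.
move=> mD mB NJ; pose B' n := if n == N then D else B n.
have mB' n : measurable (B' n) by rewrite /B'; case: ifP.
have B'J n : n \in J -> B' n = B n.
  by rewrite /B'; case: eqVneq => // -> /(negP NJ).
exists B'; split => //.
- apply/seteqP; split => [w /= h|w [hN h] n /=].
    split; first by have := h N; rewrite /= /B' eqxx; apply; rewrite fset1U1.
    by move=> n /= nJ; have := h n; rewrite /= B'J//; apply; rewrite fset1Ur.
  move=> /fset1UP[->|nJ]; first by rewrite /B' eqxx.
  by rewrite B'J//; exact: h.
- rewrite /cylinder hindep// big_fsetU1//= hindep//; congr (_ * _)%E.
    by rewrite /B' eqxx.
  by apply: eq_big_seq => n nJ; rewrite B'J.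
Qed.

(** The sum of the first [N] terms is independent of the variables of index at
least [N].  In the step from [N] to [N.+1] the next sum is a function of the
pair formed by the sum and [g N], and [joint_law_indep] applies to this pair. *)
Lemma gaussian_sum_indep a N (C : set R[i]) (J : {fset nat})
    (B : nat -> set R[i]) :
  measurable C -> (forall n, measurable (B n)) ->
  (forall n, n \in J -> (N <= n)%N) ->
  P (gaussian_sum a N @^-1` C `&` cylinder J B) =
  (P (gaussian_sum a N @^-1` C) * P (cylinder J B))%E.
Proof.
elim: N C J B => [|N IH] C J B mC mB NJ.
  have -> : gaussian_sum a 0 = cst 0.
    by apply/funext => w; rewrite /gaussian_sum big_ord0.
  rewrite preimage_cst; case: ifPn => _.
    by rewrite setTI probability_setT mul1e.
  by rewrite set0I measure0 mul0e.
pose U : set (R[i] * R[i]) := [set z | C (z.1 + z.2 * a N)].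
have mU : measurable U.
  rewrite /U -[X in measurable X]setTI.
  apply: (_ : measurable_fun setT (fun z : R[i] * R[i] => z.1 + z.2 * a N)) => //.
  by apply: measurable_complexD => //; exact: measurable_complexM.
have UE : gaussian_sum a N.+1 @^-1` C = [set w | U (gaussian_sum a N w, g N w)].
  by apply/funext => w; rewrite /U/= /preimage/= gaussian_sumS.
have key J' B' : (forall n, measurable (B' n)) ->
    (forall n, n \in J' -> (N.+1 <= n)%N) ->
    P (gaussian_sum a N.+1 @^-1` C `&` cylinder J' B') =
    (P (cylinder J' B') *
      (distribution P (gaussian_sum a N) \x distribution P (g N)) U)%E.
  move=> mB' NJ'; rewrite UE; apply: joint_law_indep => //.
    exact: measurable_cylinder.
  move=> C' D mC' mD.
  have NnJ : N \notin J' by apply/negP => /NJ'; rewrite ltnn.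
  have [B'' [mB'' B''E PE]] := indep_cylinder mD mB' NnJ.
  rewrite -setIA -B''E IH//; last first.
    by move=> n; move=> /fset1UP[->//|/NJ'/ltnW].
  by rewrite PE muleA [RHS]muleC.
(* The cylinder over no index is the sure event: [key] then evaluates the
   probability of the sum alone. *)
rewrite key// muleC; congr (_ * _)%E.
have := @key fset0 B mB; rewrite cylinder0 setIT.
by rewrite probability_setT mul1e => <-.
Qed.

Hypothesis hgauss : forall n, complex_gaussian 1 (g n).

(** Integrating out [g N] turns [heat v] into
[v / (v + |a_N|^2) * heat (v + |a_N|^2)], which is why the induction on [N]
needs all [v] at once; the product of the factors telescopes. *)
Lemma expectation_heat_gaussian_sum a N v : 0 < v ->
  (\int[P]_w (heat v (gaussian_sum a N w))%:E =
   (v / (v + \sum_(n < N) normc (a n) ^+ 2))%:E)%E.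
Proof.
elim: N v => [|N IH] v v0.
  under eq_integral do
    rewrite /gaussian_sum big_ord0 /heat normc0 expr0n/= mul0r oppr0 expR0.
  rewrite integral_cst// mul1e; transitivity (1%E : \bar R).
    exact: probability_setT.
  by rewrite big_ord0 addr0 divff// gt_eqF.
pose S : {mfun Omega >-> R[i]} := gaussian_sum a N.
have mSX : measurable_fun setT (fun w => (S w, g N w)).
  exact: measurable_fun_pair.
pose f (z : R[i] * R[i]) := (heat v (z.1 + a N * z.2))%:E.
have mf : measurable_fun setT f.
  apply/measurable_EFinP/measurable_heat/measurable_complexD => //.
  exact: measurable_complexM.
have f0 z : (0 <= f z)%E by rewrite lee_fin heat_ge0.
have vA : 0 < v + normc (a N) ^+ 2 by rewrite ltr_wpDr ?sqr_ge0.
transitivity (\int[distribution P S \x distribution P (g N)]_z f z)%E.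
  transitivity (\int[pushforward P (fun w => (S w, g N w))]_z f z)%E.
    rewrite ge0_integral_pushforward// ?preimage_setT.
    by apply: eq_integral => w _; rewrite /f /= gaussian_sumS (mulrC (a N)).
  apply: eq_measure_integral => U mU _.
  have := @joint_law_indep _ _ _ _ _ _ _ P S (g N) setT measurableT.
  rewrite probability_setT => /(_ _ _ mU); rewrite setIT mul1e; apply.
  move=> C D mC mD; rewrite setIT mul1e.
  have [B' [mB' B'E PE]] :=
    @indep_cylinder N D fset0 (fun=> setT) mD (fun=> measurableT) isT.
  move: PE B'E; rewrite cylinder0 setIT probability_setT mule1.
  move=> PE B'E; rewrite -B'E gaussian_sum_indep ?PE//.
  by move=> n /fset1UP[->//|]; rewrite in_fset0.
rewrite fubini_tonelli1// /fubini_F.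
under eq_integral => z _.
  rewrite integral_gaussian_heat// EFinM.
  over.
rewrite ge0_integralZl//; last 3 first.
- exact/measurable_EFinP/measurable_heat.
- by move=> z _; rewrite lee_fin heat_ge0.
- by rewrite lee_fin divr_ge0// ltW.
rewrite ge0_integral_distribution//; last 2 first.
- exact/measurable_EFinP/measurable_heat.
- by move=> z; rewrite lee_fin heat_ge0.
have := IH _ vA; rewrite /comp => ->.
rewrite -EFinM mulrA divfK ?gt_eqF// big_ord_recr/=.
by rewrite -addrA (addrC (normc (a N) ^+ 2)).
Qed.

(** Markov's inequality: [heat (r^2)] is at least [exp(- 1/2)] on the disc of
radius [r]. *)
Lemma gaussian_sum_small_ball a N r : 0 < r ->
  (P [set w | (normc (gaussian_sum a N w) <= r)%R] <=
   (expR 2^-1 * (r ^+ 2 / (r ^+ 2 + \sum_(n < N) normc (a n) ^+ 2)))%:E)%E.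
Proof.
move=> r0; have r20 : 0 < r ^+ 2 by rewrite exprn_gt0.
set A := [set w | _].
have mA : measurable A by exact/measurable_le_normc/measurable_gaussian_sum.
rewrite -[leLHS](_ : \int[P]_w (\1_A w)%:E = _)%E; last first.
  by rewrite integral_indic// setIT.
rewrite EFinM -(expectation_heat_gaussian_sum a N r20).
rewrite -ge0_integralZl//; last 2 first.
- exact/measurable_EFinP/measurable_heat/measurable_gaussian_sum.
- by move=> z _; rewrite lee_fin heat_ge0.
have mh := measurable_heat (r ^+ 2) (measurable_gaussian_sum a N).
apply: ge0_le_integral => //.
- by apply/measurable_EFinP; exact: measurable_indic.
- by apply: emeasurable_funM => //; exact/measurable_EFinP.
move=> w _; rewrite -EFinM lee_fin indicE.
case: (boolP (w \in A)) => [|_]; last first.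
  by apply: mulr_ge0; [exact: expR_ge0|exact: heat_ge0].
rewrite inE /A/= => wr; rewrite /heat -expRD -[leLHS](@expR0 R) ler_expR subr_ge0.
rewrite ler_pdivrMr ?mulr_gt0// mulrA mulVf// mul1r.
by rewrite lerXn2r// nnegrE ?normc_ge0// ltW.
Qed.

End gaussian_sum.

(** * From the partial sums to their limit *)

Section frequently_small.
Local Open Scope ereal_scope.
Context d (T : measurableType d) (R : realType).
Variable mu : {measure set T -> \bar R}.

(** Convergence to 0 in mean does not give convergence almost everywhere without
passing to a subsequence, but each tail infimum [inf_(N >= K) h N] has integral
0, and this is enough to find arbitrarily late small terms. *)
Lemma ae_frequently_small (h : nat -> T -> \bar R) :
  (forall n, measurable_fun setT (h n)) -> (forall n x, 0 <= h n x) ->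
  \int[mu]_x h n x @[n --> \oo] --> 0 ->
  {ae mu, forall x, forall (eps : R) K, (0 < eps)%R ->
    exists2 N, (K <= N)%N & h N x < eps%:E}.
Proof.
move=> mh h0 inth.
pose i K x := einfs (h ^~ x) K.
have i0 K x : 0 <= i K x by apply: le_ereal_inf_tmp => _ [n _ <-].
have mi K : measurable_fun setT (i K) by exact: measurable_fun_einfs.
have ae0 K : {ae mu, forall x, i K x = 0}.
  have : \int[mu]_x `|i K x| = 0.
    apply/eqP; rewrite eq_le integral_ge0// andbT.
    apply: (cvge_to_ge inth); near=> N.
    apply: ge0_le_integral => //; first exact: measurableT_comp.
    move=> x _; rewrite gee0_abs//; apply: ereal_inf_lbound; exists N => //=.
    by near: N; exact: nbhs_infty_ge.
  by move=> /(ae_eq_integral_abs mu measurableT (mi K)); apply: filterS => x; exact.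
have : {ae mu, forall x, forall K, i K x = 0} by exact: ae_foralln.
apply: filterS => x ix eps K eps0.
have : i K x < eps%:E by rewrite ix lte_fin.
by move=> /ereal_inf_lt [_ [N /= KN <-] hN]; exists N.
Unshelve. all: by end_near. Qed.

End frequently_small.

Section small_ball_limit.
Context {R : realType} d (Omega : measurableType d) (P : probability Omega R).
Variable g : nat -> {RV P >-> R[i]}.
Hypothesis hgauss : forall n, complex_gaussian 1 (g n).
Hypothesis hindep : mutually_independent g.

(** If [|f| <= r] then either [|S_N| <= 2 r] or [|f - S_N| >= r]; the second
event has a small probability by the choice of [N], and the first one is
controlled by [gaussian_sum_small_ball].  The sum stops at the fixed index
[K <= N]: a shorter sum only weakens the bound. *)
Lemma limit_small_ball (f : Omega -> R[i]) (a : nat -> R[i]) K r :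
  measurable_fun setT f ->
  (forall (eps : R) K, 0 < eps -> exists2 N, (K <= N)%N &
    (\int[P]_w (normc (f w - gaussian_sum g a N w) ^+ 2)%:E < eps%:E)%E) ->
  0 < r ->
  (P [set w | (normc (f w) <= r)%R] <= (expR 2^-1 *
    ((2 * r) ^+ 2 / ((2 * r) ^+ 2 + \sum_(n < K) normc (a n) ^+ 2)))%:E)%E.
Proof.
move=> mf approx r0.
set s := \sum_(n < K) _.
have s0 : 0 <= s by apply: sumr_ge0 => n _; rewrite sqr_ge0.
have r20 : 0 < r ^+ 2 by rewrite exprn_gt0.
apply/lee_addgt0Pr => eps eps0.
have [N KN hN] := approx (eps * r ^+ 2) K (mulr_gt0 eps0 r20).
set B := [set w | normc (gaussian_sum g a N w) <= 2 * r].
set D := [set w |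
  (r ^+ 2)%:E <= `|(normc (f w - gaussian_sum g a N w) ^+ 2)%:E|]%E.
have mdiff : measurable_fun setT (fun w => f w - gaussian_sum g a N w).
  apply: measurable_complexD => //.
  exact/measurable_complexN/measurable_gaussian_sum.
have mdiff2 : measurable_fun setT
    (fun w => (normc (f w - gaussian_sum g a N w) ^+ 2)%:E).
  by apply/measurable_EFinP/measurable_funX/measurable_normc.
have mB : measurable B by apply/measurable_le_normc/measurable_gaussian_sum.
have mD : measurable D.
  rewrite -[D]setTI; apply: emeasurable_fun_c_infty => //.
  exact: measurableT_comp.
apply: (@le_trans _ _ (P (B `|` D))).
  apply: le_measure; rewrite ?inE; [exact: measurable_le_normc|exact: measurableU|].
  move=> w /= fr; rewrite /B /D /=.
  have [|r2] := leP (normc (gaussian_sum g a N w)) (2 * r); [by left|right].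
  rewrite lee_fin ger0_norm ?sqr_ge0// lerXn2r ?nnegrE ?normc_ge0 ?(ltW r0)//.
  have := le_normcD (f w) (gaussian_sum g a N w - f w).
  rewrite addrC subrK -[in normc (_ - f w)]opprB normcN.
  lra.
apply: (le_trans (measureU2 _ mB mD)); apply: leeD.
  apply: (le_trans (gaussian_sum_small_ball hindep hgauss a N _)).
    by rewrite mulr_gt0.
  rewrite lee_fin ler_wpM2l ?expR_ge0// ler_wpM2l ?sqr_ge0//.
  have h4 : 0 < (2 * r) ^+ 2 by rewrite exprn_gt0// mulr_gt0.
  rewrite lef_pV2 ?posrE ?ltr_wpDr//; last first.
    by apply: sumr_ge0 => n _; rewrite sqr_ge0.
  rewrite lerD2l /s -(subnKC KN) big_split_ord/= lerDl.
  by apply: sumr_ge0 => n _; rewrite sqr_ge0.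
rewrite -(@lee_pmul2l _ (r ^+ 2)%:E)// ?lte_fin// -EFinM (mulrC (r ^+ 2)).
apply: le_trans (ltW hN).
have := le_integral_abse P measurableT mdiff2 r20.
rewrite setTI => /le_trans; apply.
by under eq_integral do rewrite gee0_abs ?lee_fin ?sqr_ge0//.
Qed.

End small_ball_limit.

(** * Lower bounds for moments *)

Section power_sums.
Context {R : realType}.

(** Each [x n] is at most the Euclidean norm [s], hence
[x n ^ p = x n ^ 2 * x n ^ (p - 2) <= x n ^ 2 * s ^ (p - 2)]. *)
Lemma sum_powR_le (x : nat -> R) K p : 2 <= p -> (forall n, 0 <= x n) ->
  \sum_(n < K) x n `^ p <= Num.sqrt (\sum_(n < K) x n ^+ 2) `^ p.
Proof.
move=> p2 x0; set s := Num.sqrt _.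
have p0 : 2 + (p - 2) != 0 by rewrite addrC subrK gt_eqF// (lt_le_trans _ p2).
have pE : p = 2 + (p - 2) by rewrite addrC subrK.
have split2 y : 0 <= y -> y `^ p = y ^+ 2 * y `^ (p - 2).
  by move=> y0; rewrite {1}pE powRD ?(negbTE p0)// -powR_mulrn.
have s2 : s ^+ 2 = \sum_(n < K) x n ^+ 2.
  by rewrite sqr_sqrtr// sumr_ge0// => n _; rewrite sqr_ge0.
rewrite split2 ?sqrtr_ge0// s2 mulr_suml; apply: ler_sum => n _.
rewrite split2// ler_wpM2l ?sqr_ge0// ge0_ler_powR ?subr_ge0 ?nnegrE ?sqrtr_ge0//.
rewrite -(@ler_sqr R) ?nnegrE ?sqrtr_ge0// s2 (bigD1 n)//= lerDl.
by apply: sumr_ge0 => m _; rewrite sqr_ge0.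
Qed.
End power_sums.

Section moment_lower_bound.
Context {R : realType} d (Omega : measurableType d) (P : probability Omega R).

(** The square root is the ratio [t] for which the bound [4 exp(1/2) t^2] of the
small ball estimate equals [delta / 2]. *)
Definition moment_constant (p delta : R) : R :=
  delta / 2 * Num.sqrt (delta / (8 * expR 2^-1)) `^ p.

Lemma moment_constant_gt0 p delta : 0 < delta -> 0 < moment_constant p delta.
Proof.
move=> delta0; rewrite mulr_gt0 ?divr_gt0// powR_gt0// sqrtr_gt0.
by rewrite divr_gt0// mulr_gt0// expR_gt0.
Qed.

(** At least half of [A], in probability, lies outside the event
[|f| <= t sqrt s], where [s = \sum_(n < K) |a n|^2]. *)
Lemma moment_lower_bound (f : Omega -> R[i]) (a : nat -> R[i]) K p A delta :
  measurable_fun setT f -> 2 <= p ->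
  measurable A -> 0 < delta -> P A = delta%:E ->
  (forall r, 0 < r -> (P [set w | (normc (f w) <= r)%R] <= (expR 2^-1 *
    ((2 * r) ^+ 2 / ((2 * r) ^+ 2 + \sum_(n < K) normc (a n) ^+ 2)))%:E)%E) ->
  ((moment_constant p delta * \sum_(n < K) normc (a n) `^ p)%:E <=
    \int[P]_(w in A) (normc (f w) `^ p)%:E)%E.
Proof.
move=> mf p2 mA delta0 PA small_ball.
have p0 : 0 < p by rewrite (lt_le_trans _ p2).
have := sum_powR_le K p2 (fun n => normc_ge0 (a n)).
set s := (\sum_(n < K) normc (a n) ^+ 2) in small_ball *.
have : 0 <= s by apply: sumr_ge0 => n _; rewrite sqr_ge0.
rewrite le_eqVlt => /predU1P[<-|s0].
  rewrite sqrtr0 powR0 ?gt_eqF// => le0; apply: (@le_trans _ _ 0%E).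
    by rewrite lee_fin pmulr_rle0// moment_constant_gt0.
  by apply: integral_ge0 => w _; rewrite lee_fin powR_ge0.
move=> sum_le; rewrite /moment_constant.
set t := Num.sqrt _.
have e0 : 0 < expR 2^-1 :> R by exact: expR_gt0.
have t2 : t ^+ 2 = delta / (8 * expR 2^-1).
  by rewrite sqr_sqrtr// divr_ge0 ?ltW// mulr_gt0.
have t0 : 0 < t by rewrite sqrtr_gt0 divr_gt0// mulr_gt0.
pose r := t * Num.sqrt s.
have r0 : 0 < r by rewrite mulr_gt0// sqrtr_gt0.
pose B := [set w | normc (f w) <= r].
have mB : measurable B by exact: measurable_le_normc.
have mfp : measurable_fun setT (fun w => (normc (f w) `^ p)%:E).
  apply/measurable_EFinP; apply: (measurableT_comp (measurable_powR _)).
  exact: measurable_normc.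
have PB : (P B <= (delta / 2)%:E)%E.
  apply: (le_trans (small_ball _ r0)); rewrite lee_fin.
  have r2 : r ^+ 2 = delta / (8 * expR 2^-1) * s.
    by rewrite exprMn t2 sqr_sqrtr// ltW.
  have rs : (2 * r) ^+ 2 / ((2 * r) ^+ 2 + s) <= (2 * r) ^+ 2 / s.
    rewrite ler_wpM2l ?sqr_ge0// lef_pV2 ?posrE ?ltr_wpDl ?sqr_ge0//.
    by rewrite lerDr sqr_ge0.
  apply: (le_trans (ler_wpM2l (ltW e0) rs)).
  rewrite exprMn r2 le_eqVlt; apply/orP; left; apply/eqP.
  clear -e0 s0; move: e0 s0; move: (expR _) (s) => x y x0 y0.
  by field; rewrite !gt_eqF.
have PAB : ((delta / 2)%:E <= P (A `\` B))%E.
  have : (P A <= P B + P (A `\` B))%E.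
    apply: (@le_trans _ _ (P (B `|` (A `\` B)))).
      apply: le_measure; rewrite ?inE//.
        by apply: measurableU => //; exact: measurableD.
      by move=> w Aw; have [Bw|nBw] := pselect (B w); [left|right].
    by apply: measureU2 => //; exact: measurableD.
  rewrite PA => /le_trans => /(_ _ (leeD2r _ PB)).
  rewrite -leeBlDl// -EFinB; congr (_ <= _)%E.
  by congr EFin; field.
apply: (@le_trans _ _ (\int[P]_(w in A `\` B) (normc (f w) `^ p)%:E)%E); last first.
  apply: ge0_subset_integral => //; [exact: measurableD|exact: measurable_funTS|].
  by move=> w _; rewrite lee_fin powR_ge0.
apply: (@le_trans _ _ (\int[P]_(w in A `\` B) (r `^ p)%:E)%E); last first.
  apply: ge0_le_integral => //.
  - exact: measurableD.
  - by move=> w _; rewrite lee_fin powR_ge0.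
  - exact: measurable_funTS.
  move=> w [_ /negP]; rewrite -ltNge => rf; rewrite lee_fin.
  by rewrite ge0_ler_powR ?nnegrE ?normc_ge0 ?ltW.
rewrite integral_cst//; last exact: measurableD.
apply: (@le_trans _ _ ((r `^ p)%:E * (delta / 2)%:E)%E); last first.
  by rewrite lee_pmul2l// lte_fin powR_gt0.
rewrite -EFinM lee_fin [leRHS]mulrC -mulrA ler_pM2l ?divr_gt0//.
rewrite /r powRM ?sqrtr_ge0// ?(ltW t0)//.
by apply: ler_wpM2l => //; exact: powR_ge0.
Qed.

End moment_lower_bound.

Section cLnorm_facts.
Context {R : realType} d (T : measurableType d) (mu : {measure set T -> \bar R}).

Lemma cLnorm_powR (p : R) (f : T -> R[i]) : p != 0 ->
  ((cLnorm mu p f) `^ p = \int[mu]_x (normc (f x) `^ p)%:E)%E.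
Proof.
move=> p0; rewrite /cLnorm (poweR_Lnorm _ _ p0); apply: eq_integral => x _.
by rewrite abse_EFin ger0_norm ?normc_ge0// poweR_EFin.
Qed.

End cLnorm_facts.

(** * The random series *)

Section series.
Context (R : realType) (dY : measure_display) (Y : measurableType dY)
  (mu : {finite_measure set Y -> \bar R})
  (dO : measure_display) (Omega : measurableType dO) (P : probability Omega R)
  (g : nat -> {RV P >-> R[i]}) (e : nat -> Y -> R[i]) (c : nat -> R[i])
  (F : Omega * Y -> R[i]).
Hypothesis me : forall n, measurable_fun setT (e n).
Hypothesis hgauss : forall n, complex_gaussian 1 (g n).
Hypothesis hindep : mutually_independent g.
Hypothesis hF : is_gaussian_series mu g c e F.

(** By Fubini, [E |F(., y) - S_N|^2] tends to 0 in mean with respect to [y]. *)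
Lemma ae_series_small_ball : {ae mu, forall y, forall K r, 0 < r ->
  (P [set w | (normc (F (w, y)) <= r)%R] <= (expR 2^-1 *
    ((2 * r) ^+ 2 /
     ((2 * r) ^+ 2 + \sum_(n < K) normc (c n * e n y) ^+ 2)))%:E)%E}.
Proof.
have [[mF _] F_lim] := hF.
pose G N (z : Omega * Y) := F z - \sum_(n < N) g n z.1 * c n * e n z.2.
have GE N w y : G N (w, y) =
    F (w, y) - gaussian_sum g (fun n => c n * e n y) N w.
  by congr (_ - _); apply: eq_bigr => n _; rewrite mulrA.
have mG N : measurable_fun setT (G N).
  apply: measurable_complexD => //; apply: measurable_complexN.
  apply: (measurable_complex_sum
    (f := fun n (z : Omega * Y) => g n z.1 * c n * e n z.2)) => n.
  apply: measurable_complexM; last exact: (measurableT_comp (me n)).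
  apply: measurable_complexM => //.
  exact: (measurableT_comp (measurable_funPT (g n))).
have mG2 N : measurable_fun setT (fun z => (normc (G N z) ^+ 2)%:E).
  by apply/measurable_EFinP/measurable_funX/measurable_normc.
have G20 N z : (0 <= (normc (G N z) ^+ 2)%:E)%E by rewrite lee_fin sqr_ge0.
pose h N y := (\int[P]_w (normc (G N (w, y)) ^+ 2)%:E)%E.
have inth : (\int[mu]_y h N y @[N --> \oo] --> 0)%E.
  have hE N : (\int[mu]_y h N y = cLnorm (P \x mu)%E 2 (G N) `^ 2)%E.
    rewrite cLnorm_powR// -[LHS](fubini_tonelli2 _ (mG2 N) (G20 N)).
    by apply: eq_integral => z _; rewrite (powR_mulrn 2) ?normc_ge0.
  under eq_fun do rewrite hE.
  (* The squares of the norms tend to 0 as the norms do: the square of a norm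
     that is at most 1 is at most this norm. *)
  apply: (squeeze_cvge _ (cvg_cst _) F_lim).
  have : \forall N \near \oo, (cLnorm (P \x mu)%E 2 (G N) < 1)%E.
    apply: (F_lim [set x | (x < 1)%E]).
    exact: (open_ereal_lt' (lte01 : (0 < 1 :> \bar R)%E)).
  apply: filterS => N /ltW G1; rewrite poweR_ge0/=.
  have : (0 <= cLnorm (P \x mu)%E 2 (G N))%E by exact: Lnorm_ge0.
  rewrite /G in G1 *.
  move: (cLnorm _ _ _) G1 => [x| |]//; rewrite !lee_fin => x1 x0.
  by rewrite (powR_mulrn 2)// expr2 ler_piMl.
have mh N : measurable_fun setT (h N).
  exact: (measurable_fun_fubini_tonelli_G _ (mG2 N)).
have h0 N y : (0 <= h N y)%E by apply: integral_ge0.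
have := ae_frequently_small mh h0 inth.
apply: filterS => y small K r r0.
apply: (limit_small_ball hgauss hindep (a := fun n => c n * e n y)) => //.
  exact: (measurableT_comp mF (pair2_measurable y)).
move=> eps K' eps0; have [N KN hN] := small eps K' eps0.
exists N => //; move: hN; rewrite /h.
by under eq_integral do rewrite GE.
Qed.

(** Fubini on [A * Y]: [moment_lower_bound] bounds the inner integral over [A]
from below for almost every [y], and the definition of [A] bounds the inner
integral over [Y] from above. *)
Lemma sum_moments_bound p M K delta : 2 <= p -> 0 <= M -> 0 < delta ->
  P [set w | \int[mu]_y (normc (F (w, y)) `^ p)%:E <= M%:E]%E = delta%:E ->
  (\sum_(0 <= n < K) ((normc (c n) `^ p)%:E * cLnorm mu p (e n) `^ p) <=
    (M / moment_constant p delta)%:E)%E.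
Proof.
move=> p2 M0 delta0; set A := [set w | _] => PA.
have p0 : 0 < p by rewrite (lt_le_trans _ p2).
have mF := hF.1.1.
pose Fp (z : Omega * Y) := (normc (F z) `^ p)%:E.
have mpow d (T : measurableType d) (f : T -> R[i]) : measurable_fun setT f ->
    measurable_fun setT (fun x => (normc (f x) `^ p)%:E).
  move=> mf; apply/measurable_EFinP.
  apply: (measurableT_comp (measurable_powR _)).
  exact: measurable_normc.
have mFp : measurable_fun setT Fp by exact: mpow.
have Fp0 z : (0 <= Fp z)%E by rewrite lee_fin powR_ge0.
have mA : measurable A.
  have := measurable_fun_fubini_tonelli_F Fp (m2 := mu) mFp Fp0.
  move=> /(_ measurableT `]-oo, M%:E]%classic (emeasurable_itv _)); rewrite setTI.
  by congr measurable.
pose C := moment_constant p delta.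
have C0 : 0 < C by exact: moment_constant_gt0.
pose H (z : Omega * Y) := ((\1_A z.1)%:E * Fp z)%E.
have mH : measurable_fun setT H.
  apply: emeasurable_funM => //; apply/measurable_EFinP.
  exact: (measurableT_comp (measurable_indic mA)).
have H0 z : (0 <= H z)%E by rewrite mule_ge0// lee_fin.
have upper : (\int[mu]_y \int[P]_w H (w, y) <= M%:E)%E.
  rewrite -fubini_tonelli//.
  apply: (@le_trans _ _ (\int[P]_w (cst M%:E w))%E); last first.
    rewrite integral_cst// [X in (_ * X)%E](_ : _ = 1%E) ?mule1//.
    exact: probability_setT.
  apply: ge0_le_integral => //.
  - by move=> w _; apply: integral_ge0.
  - exact: (measurable_fun_fubini_tonelli_F _ mH).
  move=> w _; rewrite /H/=.
  under eq_integral do rewrite muleC.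
  rewrite ge0_integralZr//; last first.
    exact: (measurableT_comp mFp (pair1_measurable w)).
  rewrite indicE; case: (boolP (w \in A)) => [|_]; last by rewrite mule0 lee_fin.
  by rewrite inE mule1.
have lower : (\int[mu]_y (C * \sum_(n < K) normc (c n * e n y) `^ p)%:E <=
    \int[mu]_y \int[P]_w H (w, y))%E.
  apply: ae_ge0_le_integral => //.
  - move=> y _; rewrite lee_fin mulr_ge0 ?(ltW C0)// sumr_ge0// => n _.
    exact: powR_ge0.
  - apply/measurable_EFinP/measurable_funM => //; apply: measurable_sum => n.
    by apply/measurable_EFinP/mpow/measurable_complexM.
  - by move=> y _; apply: integral_ge0.
  - exact: (measurable_fun_fubini_tonelli_G _ mH).
  have := ae_series_small_ball; apply: filterS => y ball _.
  have mFy : measurable_fun setT (fun w => F (w, y)).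
    exact: (measurableT_comp mF (pair2_measurable y)).
  apply: (le_trans (moment_lower_bound (a := fun n => c n * e n y)
    mFy p2 mA delta0 PA (ball K))).
  rewrite integral_mkcond le_eqVlt; apply/orP; left; apply/eqP.
  apply: eq_integral => w _; rewrite patchE /H indicE /Fp.
  by case: ifPn => _; rewrite ?mul1e ?mul0e.
have := le_trans lower upper.
under eq_integral do rewrite EFinM.
rewrite ge0_integralZl//; last 3 first.
- apply/measurable_EFinP; apply: measurable_sum => n.
  by apply/measurable_EFinP/mpow/measurable_complexM.
- by move=> y _; rewrite lee_fin sumr_ge0// => n _; exact: powR_ge0.
- by rewrite lee_fin ltW.
move=> CM; rewrite EFinM lee_pdivlMr//.
apply: le_trans CM; rewrite muleC lee_pmul2l ?lte_fin//.
under [leRHS]eq_integral do rewrite -sumEFin.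
rewrite ge0_integral_sum//; last 2 first.
- by move=> n; exact/mpow/measurable_complexM.
- by move=> n y _; rewrite lee_fin powR_ge0.
rewrite big_mkord; apply: lee_sum => n _.
rewrite cLnorm_powR ?gt_eqF// -ge0_integralZl//; last 3 first.
- exact: mpow.
- by move=> y _; rewrite lee_fin powR_ge0.
- by rewrite lee_fin powR_ge0.
by under [leRHS]eq_integral do rewrite normcM powRM ?normc_ge0// EFinM.
Qed.

End series.

Theorem theorem3 (R : realType) (p : R) (hp : 2 <= p)
  (dY : measure_display) (Y : measurableType dY)
  (mu : {finite_measure set Y -> \bar R})
  (e : nat -> Y -> R[i]) (he : orthonormal_basis mu e)
  (dO : measure_display) (Omega : measurableType dO)
  (P : probability Omega R)
  (g : nat -> {RV P >-> R[i]})
  (hgauss : forall n, complex_gaussian 1 (g n))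
  (hindep : mutually_independent g)
  (c : nat -> R[i]) (hc : in_l2 c)
  (F : Omega * Y -> R[i]) (hF : is_gaussian_series mu g c e F)
  (hdiv : (\sum_(0 <= n <oo)
     ((normc (c n) `^ p)%:E * (cLnorm mu p (e n)) `^ p) = +oo)%E) :
  {ae P, forall w, cLnorm mu p (fun y => F (w, y)) = +oo%E}.
Proof.
have p0 : p != 0 by rewrite gt_eqF// (lt_le_trans _ hp).
have me n : measurable_fun setT (e n) := (orthonormal_basis_L2 he n).1.
have mF := hF.1.1.
pose I w := (\int[mu]_y (normc (F (w, y)) `^ p)%:E)%E.
have I0 w : (0 <= I w)%E.
  by apply: integral_ge0 => y _; rewrite lee_fin powR_ge0.
have mI : measurable_fun setT I.
  apply: (@measurable_fun_fubini_tonelli_F _ _ _ _ _ mu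
    (fun z => (normc (F z) `^ p)%:E)).
    apply/measurable_EFinP; apply: (measurableT_comp (measurable_powR _)).
    exact: measurable_normc.
  by move=> z; rewrite lee_fin powR_ge0.
pose A M := [set w | (I w <= M%:R%:E)%E].
have mA M : measurable (A M).
  have := mI measurableT `]-oo, M%:R%:E]%classic (emeasurable_itv _).
  by rewrite setTI; congr measurable.
have nullA M : P (A M) = 0%E.
  apply/eqP/negPn/negP => PA.
  have PAfin : P (A M) \is a fin_num by exact: fin_num_measure.
  have delta0 : 0 < fine (P (A M)).
    by rewrite fine_gt0// lt0e PA measure_ge0/= ltey_eq PAfin.
  have PAE : P (A M) = (fine (P (A M)))%:E by rewrite fineK.
  have bound K :=
    sum_moments_bound me hgauss hindep hF K hp (ler0n _ M) delta0 PAE.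
  suff : (+oo <= (M%:R / moment_constant p (fine (P (A M))))%:E)%E by [].
  rewrite -hdiv; apply: lime_le; last exact: nearW.
  apply: is_cvg_ereal_nneg_natsum => n _.
  by rewrite mule_ge0 ?poweR_ge0// lee_fin powR_ge0.
suff : P.-negligible
  (~` [set w | cLnorm mu p (fun y => F (w, y)) = +oo%E]) by [].
have negA M : P.-negligible (A M) by apply/(negligibleP P (mA M)); exact: nullA.
apply: negligibleS (negligible_bigcup negA) => w /= Lfin.
have Ifin : I w \is a fin_num.
  rewrite ge0_fin_numE// ltNge leye_eq; apply/negP => /eqP Iy; apply: Lfin.
  by apply: (@poweR_eqy _ _ p); rewrite cLnorm_powR.
exists (Num.truncn (fine (I w))).+1 => //.
by rewrite /A/= -(fineK Ifin) lee_fin ltW// truncnS_gt.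
Qed.
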